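(* Let $p$ be a prime number, let $f\colon\mathbb{Q}_p\to\mathbb{Q}_p$ be the map defined in the context, and regard $\mathbb{Z}[\frac1p]\subset\mathbb{Q}\subset\mathbb{Q}_p$. For every $x\in\mathbb{Q}_p$, one has $x\in\mathbb{Q}$ if and only if $f(x)\in\mathbb{Z}[\frac1p]$. Furthermore, $f(\mathbb{Q})=\mathbb{Z}[\frac1p]$.
   Context: $p$ is a fixed prime; $\mathbb{N}$ includes $0$; $v\colon\mathbb{Q}_p\to\mathbb{Z}\cup\{\infty\}$ is the $p$-adic valuation and $|x|_p=p^{-v(x)}$ for $x\neq 0$, $|0|_p=0$. Define $\epsilon(x):=|x|_p\,x\in\mathbb{Z}_p^\times$ for $x\in\mathbb{Q}_p^\times$ (here $|x|_p$ is viewed as the rational number $p^{-v(x)}$), and $\epsilon(0):=1$. Thus $x/\epsilon(x)=p^{v(x)}$ for $x\neq0$, and $0/\epsilon(0)=0$. For $x\in\mathbb{Z}_p$, $\lfloor x\rfloor_p$ is the unique element of $\{0,\ldots,p-1\}$ with $|x-\lfloor x\rfloor_p|_p<1$. Schneider's continued fraction map is $\tau\colon\mathbb{Q}_p\to\mathbb{Q}_p$, $\tau(x):=\frac{1}{\epsilon(x)}-\left\lfloor\frac{1}{\epsilon(x)}\right\rfloor_p$. The map $f\colon\mathbb{Q}_p\to\mathbb{Q}_p$ is defined by the series, convergent in $\mathbb{Q}_p$, $f(x):=\sum_{n=0}^{\infty}\left\lfloor \frac{1}{\epsilon(\tau^n(x))}\right\rfloor_p\prod_{m=0}^n\frac{\tau^m(x)}{\epsilon(\tau^m(x))}$,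 where $\tau^n$ is the $n$-fold iterate and $\tau^0$ is the identity. *)

(* Defs.v *)
From HB Require Import structures.
From mathcomp Require Import all_boot all_order all_algebra.
From mathcomp Require Import all_classical all_reals all_analysis.
From mathcomp Require Import generic_quotient ring_quotient ring lra.
Set Implicit Arguments. Unset Strict Implicit. Unset Printing Implicit Defensive.
Import Order.TTheory GRing.Theory Num.Theory.
Local Open Scope classical_set_scope.
Local Open Scope quotient_scope.
Local Open Scope ring_scope.

Section NormRat.
Context (p : nat).

(* Only meaningful for q != 0; the value v(0) = oo is handled in [normQ]. *)
Definition valQ (q : rat) : int :=
  (logn p `|numq q|%N)%:Z - (logn p `|denq q|%N)%:Z.

Definition normQ (q : rat) : rat :=
  if q == 0 then 0 else p%:R ^ (- valQ q).

Context (pr : prime p).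

Let p0 : 0 < p%:R :> rat. Proof. by rewrite ltr0n prime_gt0. Qed.
Let pn0 : p%:R != 0 :> rat. Proof. exact: lt0r_neq0. Qed.

Lemma normQ0 : normQ 0 = 0. Proof. by rewrite /normQ eqxx. Qed.

Lemma normQ_ge0 q : 0 <= normQ q.
Proof. by rewrite /normQ; case: ifP => // _; exact/exprz_ge0/ltW. Qed.

Lemma normQ_eq0 q : (normQ q == 0) = (q == 0).
Proof.
rewrite /normQ; case: ifP => _; first by rewrite eqxx.
by apply/negbTE; rewrite expfz_neq0.
Qed.

Lemma valQ_frac (a b : int) : a != 0 -> b != 0 ->
  valQ (a%:~R / b%:~R) = (logn p `|a|%N)%:Z - (logn p `|b|%N)%:Z.
Proof.
move=> a0 b0; rewrite /valQ; set q := _ / _.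
have q0 : q != 0 by rewrite mulf_neq0 ?invr_eq0 ?intr_eq0.
have E : (numq q * b = a * denq q)%R.
  apply: (@intr_inj rat); rewrite !intrM numqE mulrAC; congr (_ * _).
  by rewrite divfK ?intr_eq0.
have : (`|numq q| * `|b| = `|a| * `|denq q|)%N by rewrite -!abszM E.
move=> /(congr1 (logn p)).
rewrite !lognM ?absz_gt0 ?numq_eq0 ?denq_neq0 // => H.
apply/eqP; rewrite subr_eq addrAC eq_sym subr_eq -!PoszD eqz_nat.
by rewrite -H addnC.
Qed.

Lemma valQM x y : x != 0 -> y != 0 -> valQ (x * y) = valQ x + valQ y.
Proof.
move=> x0 y0.
rewrite -{1}(divq_num_den x) -{1}(divq_num_den y) mulf_div -!intrM.
rewrite valQ_frac ?mulf_neq0 ?numq_eq0 ?denq_neq0 //.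
rewrite !abszM !lognM ?absz_gt0 ?numq_eq0 ?denq_neq0 // /valQ.
by rewrite !PoszD opprD addrACA.
Qed.

Lemma normQM x y : normQ (x * y) = normQ x * normQ y.
Proof.
have [->|x0] := eqVneq x 0; first by rewrite mul0r normQ0 mul0r.
have [->|y0] := eqVneq y 0; first by rewrite mulr0 normQ0 mulr0.
rewrite /normQ mulf_eq0 (negbTE x0) (negbTE y0) /=.
by rewrite valQM // opprD expfzDr.
Qed.

Lemma normQ1 : normQ 1 = 1.
Proof.
by rewrite /normQ oner_eq0 /valQ (numq_int 1) (denq_int 1) subrr oppr0 expr0z.
Qed.

Lemma normQN x : normQ (- x) = normQ x.
Proof. by rewrite /normQ oppr_eq0 /valQ numqN denqN abszN. Qed.

Lemma normQB x y : normQ (x - y) = normQ (y - x).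
Proof. by rewrite -normQN opprB. Qed.

Lemma normQV x : normQ x^-1 = (normQ x)^-1.
Proof.
have [->|x0] := eqVneq x 0; first by rewrite invr0 normQ0 ?invr0.
apply: (mulIf (x := normQ x)); first by rewrite normQ_eq0.
by rewrite -normQM !mulVf ?normQ_eq0 // normQ1.
Qed.

Lemma valQD x y : x != 0 -> y != 0 -> x + y != 0 ->
  Num.min (valQ x) (valQ y) <= valQ (x + y).
Proof.
move=> x0 y0 xy0.
pose d : int := (denq x * denq y)%R; pose a : int := (numq x * denq y)%R.
pose b : int := (numq y * denq x)%R.
have d0 : d != 0 by rewrite mulf_neq0.
have a0 : a != 0 by rewrite mulf_neq0 ?numq_eq0.
have b0 : b != 0 by rewrite mulf_neq0 ?numq_eq0.
have Ex : x = a%:~R / d%:~R.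
  by rewrite !intrM -mulf_div divff ?intr_eq0 // mulr1 divq_num_den.
have Ey : y = b%:~R / d%:~R.
  by rewrite !intrM [X in _ / X]mulrC -mulf_div divff ?intr_eq0 // mulr1 divq_num_den.
have Exy : x + y = (a + b)%:~R / d%:~R by rewrite intrD mulrDl -Ex -Ey.
have ab0 : a + b != 0.
  by apply: contra xy0; rewrite Exy => /eqP ->; rewrite mul0r.
rewrite Exy Ex Ey !valQ_frac // ge_min !lerD2r !lez_nat.
set k := minn (logn p `|a|%N) (logn p `|b|%N).
have : (k <= logn p (absz (a + b)%R))%N.
  rewrite -pfactor_dvdn ?absz_gt0 //.
  rewrite -[(_ %| _)%N]/(a + b \in dvdz (p ^ k)%N).
  by rewrite rpredD // dvdzE /= pfactor_dvdn ?absz_gt0 // ?geq_minl ?geq_minr.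
by rewrite geq_min.
Qed.

Lemma normQD x y : normQ (x + y) <= Num.max (normQ x) (normQ y).
Proof.
have [->|x0] := eqVneq x 0; first by rewrite add0r le_max lexx orbT.
have [->|y0] := eqVneq y 0; first by rewrite addr0 le_max lexx.
have [->|xy0] := eqVneq (x + y) 0; first by rewrite normQ0 le_max normQ_ge0.
have := valQD x0 y0 xy0.
rewrite /normQ (negbTE x0) (negbTE y0) (negbTE xy0) le_max ge_min.
have p1 : 1 < p%:R :> rat by rewrite ltr1n prime_gt1.
by case/orP => h; apply/orP; [left|right]; rewrite ler_eXz2l // lerN2.
Qed.

Lemma normQ_lt_add x y e : normQ x < e -> normQ y < e -> normQ (x + y) < e.
Proof. by move=> hx hy; apply: le_lt_trans (normQD x y) _; rewrite gt_max hx. Qed.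

Lemma normQ_lt_eq x y : normQ (x - y) < normQ y -> normQ x = normQ y.
Proof.
move=> h; apply/eqP; rewrite eq_le; apply/andP; split.
  have := normQD (x - y) y; rewrite subrK => /le_trans; apply.
  by rewrite ge_max lexx ltW.
have := normQD (y - x) x; rewrite subrK normQB le_max => /orP[|//].
by rewrite leNgt h.
Qed.

End NormRat.

Section Completion.
Context (p : nat).

(* The unused primality argument keeps the ring structures below inferable. *)
Definition cauchyQ of prime p : {pred nat -> rat} := fun u =>
  `[< forall e, 0 < e -> exists N, forall m n, (N <= m)%N -> (N <= n)%N ->
      normQ p (u m - u n) < e >].

Context (pr : prime p).

Lemma cauchyQP u : reflect
  (forall e, 0 < e -> exists N, forall m n, (N <= m)%N -> (N <= n)%N ->
      normQ p (u m - u n) < e) (u \in cauchyQ pr).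
Proof. exact: asboolP. Qed.

Lemma cauchyQ_bounded u : u \in cauchyQ pr ->
  exists2 B, 0 < B & exists N, forall n, (N <= n)%N -> normQ p (u n) < B.
Proof.
move=> /cauchyQP/(_ 1 ltr01)[N uN].
have un0 := normQ_ge0 pr (u N).
exists (1 + normQ p (u N)); first by rewrite ltr_wpDr.
exists N => n Nn; have := normQD pr (u n - u N) (u N); rewrite subrK.
move=> /le_lt_trans; apply; rewrite gt_max ltrDr ltr01 andbT.
by rewrite (lt_le_trans (uN _ _ Nn (leqnn N))) // lerDl.
Qed.

Lemma cauchyQ_subring : subring_closed (cauchyQ pr).
Proof.
split.
- by apply/cauchyQP => e e0; exists 0%N => m n _ _; rewrite subrr normQ0.
- move=> u v /cauchyQP hu /cauchyQP hv; apply/cauchyQP => e e0.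
  have [N uN] := hu _ e0; have [M vM] := hv _ e0.
  exists (maxn N M) => m n; rewrite !geq_max => /andP[Nm Mm] /andP[Nn Mn].
  rewrite [X in normQ p X](_ : _ = (u m - u n) + (v n - v m)).
    by apply: normQ_lt_add => //; [exact: uN|exact: vM].
  by rewrite -[(u - v) m]/(u m - v m) -[(u - v) n]/(u n - v n); ring.
- move=> u v cu cv; apply/cauchyQP => e e0.
  have [A A0 [NA uA]] := cauchyQ_bounded cu.
  have [B B0 [NB vB]] := cauchyQ_bounded cv.
  have [N uN] := cauchyQP _ cu _ (divr_gt0 e0 B0).
  have [M vM] := cauchyQP _ cv _ (divr_gt0 e0 A0).
  exists (maxn (maxn NA NB) (maxn N M)) => m n.
  rewrite !geq_max => /andP[/andP[am bm] /andP[Nm Mm]].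
  move=> /andP[/andP[an bn] /andP[Nn Mn]].
  rewrite [X in normQ p X](_ : _ = u m * (v m - v n) + (u m - u n) * v n).
    apply: normQ_lt_add => //; rewrite normQM //.
      rewrite -(divfK (lt0r_neq0 A0) e) [e / A * A]mulrC.
      by apply: ltr_pM; rewrite ?normQ_ge0 // ?uA ?vM.
    rewrite -(divfK (lt0r_neq0 B0) e).
    by apply: ltr_pM; rewrite ?normQ_ge0 // ?vB ?uN.
  by rewrite -[(u * v) m]/(u m * v m) -[(u * v) n]/(u n * v n); ring.
Qed.

HB.instance Definition _ :=
  GRing.isSubringClosed.Build (nat -> rat) (cauchyQ pr) cauchyQ_subring.

Record cauchy_seq := CauchySeq {
  cauchy_val :> nat -> rat; _ : cauchy_val \in cauchyQ pr }.

HB.instance Definition _ := [isSub for cauchy_val].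
HB.instance Definition _ := [Choice of cauchy_seq by <:].
HB.instance Definition _ := [SubChoice_isSubComNzRing of cauchy_seq by <:].

Definition nullQ : {pred cauchy_seq} := fun u =>
  `[< forall e, 0 < e -> exists N, forall n, (N <= n)%N ->
      normQ p (u n) < e >].

Lemma nullQP (u : cauchy_seq) : reflect
  (forall e, 0 < e -> exists N, forall n, (N <= n)%N -> normQ p (u n) < e)
  (u \in nullQ).
Proof. exact: asboolP. Qed.

Lemma nullQ_idealr : idealr_closed nullQ.
Proof.
split.
- by apply/nullQP => e e0; exists 0%N => n _; rewrite normQ0.
- apply/negP => /nullQP/(_ 1 ltr01)[N /(_ N (leqnn N))].
  by rewrite normQ1 ltxx.
- move=> a u v /nullQP hu /nullQP hv; apply/nullQP => e e0.
  have [A A0 [NA aA]] := cauchyQ_bounded (valP a).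
  have [N uN] := hu _ (divr_gt0 e0 A0); have [M vM] := hv _ e0.
  exists (maxn NA (maxn N M)) => n.
  rewrite !geq_max => /andP[an /andP[Nn Mn]].
  apply: normQ_lt_add => //; last exact: vM.
  rewrite -[X in normQ p X]/(a n * u n) normQM //.
  rewrite -(divfK (lt0r_neq0 A0) e) [e / A * A]mulrC.
  by apply: ltr_pM; rewrite ?normQ_ge0 // ?aA ?uN.
Qed.

HB.instance Definition _ := isIdealr.Build cauchy_seq nullQ nullQ_idealr.

(* The completion of Q with respect to the p-adic absolute value. *)
Definition padic := {ideal_quot nullQ}.

HB.instance Definition _ := GRing.ComNzRing.on padic.

Definition padic_class (u : cauchy_seq) : padic := \pi_{ideal_quot nullQ} u.

Lemma padic_classP (x : padic) : {u | x = padic_class u}.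
Proof. by exists (repr (x : {ideal_quot nullQ})); rewrite /padic_class reprK. Qed.

Lemma padic_class_eq u v : padic_class u = padic_class v <-> u - v \in nullQ.
Proof. by rewrite Quotient.idealrBE; split => /eqP. Qed.

Lemma padic_class0 : padic_class 0 = 0. Proof. exact: rmorph0. Qed.
Lemma padic_class1 : padic_class 1 = 1. Proof. exact: rmorph1. Qed.
Lemma padic_classD u v : padic_class (u + v) = padic_class u + padic_class v.
Proof. exact: rmorphD. Qed.
Lemma padic_classN u : padic_class (- u) = - padic_class u.
Proof. exact: rmorphN. Qed.
Lemma padic_classM u v : padic_class (u * v) = padic_class u * padic_class v.
Proof. exact: rmorphM. Qed.

Lemma cauchyQ_norm_stab (u : cauchy_seq) : u \notin nullQ ->
  exists2 r, 0 < r & exists N, forall n, (N <= n)%N -> normQ p (u n) = r.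
Proof.
move=> /nullQP; rewrite -existsNE => -[e /not_implyP[e0 /forallNP hN]].
have [N uN] := cauchyQP _ (valP u) _ e0.
have := hN N; rewrite -existsNE => -[n /not_implyP[Nn /negP]].
rewrite -leNgt => en; exists (normQ p (u n)); first exact: lt_le_trans en.
exists N => m Nm; apply: (normQ_lt_eq pr).
exact: lt_le_trans (uN m n Nm Nn) en.
Qed.

Lemma padic_inv_exists (x : padic) : x != 0 -> exists y, y * x = 1.
Proof.
have [u ->] := padic_classP x; rewrite -padic_class0 => u0.
have {}u0 : u \notin nullQ.
  by apply: contra u0 => u0; apply/eqP/padic_class_eq; rewrite subr0.
have [r r0 [N uN]] := cauchyQ_norm_stab u0.
have un0 n : (N <= n)%N -> u n != 0.
  by move=> Nn; rewrite -(normQ_eq0 pr) uN // lt0r_neq0.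
have cv : (fun n => (u n)^-1) \in cauchyQ pr.
  apply/cauchyQP => e e0.
  have er : 0 < e * (r * r) by rewrite !mulr_gt0.
  have [M uM] := cauchyQP _ (valP u) _ er.
  exists (maxn N M) => m n; rewrite !geq_max => /andP[Nm Mm] /andP[Nn Mn].
  rewrite [X in normQ p X](_ : _ = (u n - u m) * ((u m)^-1 * (u n)^-1)).
    rewrite !normQM // !normQV // !uN // -invfM ltr_pdivrMr ?mulr_gt0 //.
    exact: uM.
  by field; rewrite !un0.
exists (padic_class (CauchySeq cv)).
rewrite -padic_classM -padic_class1; apply/padic_class_eq/nullQP => e e0.
exists N => n Nn; rewrite -[X in normQ p X]/((u n)^-1 * u n - 1).
by rewrite mulVf ?un0 // subrr normQ0.
Qed.

Definition padic_inv (x : padic) : padic := xget 0 [set y | y * x = 1].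

Lemma padic_mulVf (x : padic) : x != 0 -> padic_inv x * x = 1.
Proof. exact: (fun x0 => xgetPex 0 (padic_inv_exists x0)). Qed.

Lemma padic_invr0 : padic_inv 0 = 0.
Proof.
rewrite /padic_inv; case: xgetP => // y _ /eqP.
by rewrite mulr0 eq_sym oner_eq0.
Qed.

HB.instance Definition _ :=
  GRing.ComNzRing_isField.Build padic padic_mulVf padic_invr0.

(* The limit of |u_n|_p for any Cauchy sequence u representing x; it exists in *)
(* rat because |u_n|_p either tends to 0 or is eventually constant.            *)
Definition padic_norm (x : padic) : rat :=
  xget 0 [set r | exists2 u, padic_class u = x &
    forall e, 0 < e -> exists N, forall n, (N <= n)%N ->
      `|normQ p (u n) - r| < e].

Lemma normQ_dist x y : `|normQ p x - normQ p y| <= normQ p (x - y).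
Proof.
have tri a b : normQ p (a + b) <= normQ p a + normQ p b.
  apply: le_trans (normQD pr a b) _.
  by rewrite ge_max lerDl lerDr !normQ_ge0.
have := tri (x - y) y; have := tri (y - x) x.
rewrite !subrK (normQB p y x) => h1 h2.
by rewrite ler_norml; apply/andP; split; lra.
Qed.

Lemma padic_norm_cvg (u : cauchy_seq) r :
  (forall e, 0 < e -> exists N, forall n, (N <= n)%N ->
      `|normQ p (u n) - r| < e) ->
  padic_norm (padic_class u) = r.
Proof.
move=> ur; apply: xget_unique; first by exists u.
move=> s [v /padic_class_eq /nullQP vu vs].
apply/eqP; rewrite -subr_eq0 -normr_eq0; apply/negPn/negP => sr.
have e0 : 0 < `|s - r| / 3 by rewrite divr_gt0 // lt_def sr normr_ge0.
have [N uN] := ur _ e0; have [M vM] := vs _ e0; have [K vuK] := vu _ e0.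
pose n := maxn N (maxn M K).
have nN : (N <= n)%N by rewrite leq_maxl.
have nM : (M <= n)%N by rewrite leq_max leq_maxl orbT.
have nK : (K <= n)%N by rewrite leq_max leq_maxr orbT.
have := uN n nN; have := vM n nM.
have := le_lt_trans (normQ_dist (v n) (u n)) (vuK n nK).
set a := normQ p (v n); set b := normQ p (u n) => h1 h2 h3.
suff : `|s - r| < `|s - r| by rewrite ltxx.
rewrite [X in `|X| < _](_ : _ = (s - a) + ((a - b) + (b - r))); last by ring.
rewrite [ltRHS](_ : _ = `|s - r| / 3 + (`|s - r| / 3 + `|s - r| / 3)); last by field.
apply: le_lt_trans (ler_normD _ _) _; apply: ltrD; first by rewrite distrC.
by apply: le_lt_trans (ler_normD _ _) _; apply: ltrD.
Qed.

Lemma padic_norm_stab (u : cauchy_seq) r N :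
  (forall n, (N <= n)%N -> normQ p (u n) = r) ->
  padic_norm (padic_class u) = r.
Proof.
move=> uN; apply: padic_norm_cvg => e e0; exists N => n Nn.
by rewrite uN // subrr normr0.
Qed.

Lemma padic_norm0 : padic_norm 0 = 0.
Proof.
rewrite -padic_class0; apply: (padic_norm_stab (N := 0)) => n _.
exact: normQ0.
Qed.

Lemma padic_norm_neq0 (x : padic) : x != 0 ->
  exists u N, [/\ x = padic_class u, 0 < padic_norm x &
    forall n, (N <= n)%N -> normQ p (u n) = padic_norm x].
Proof.
have [u ->] := padic_classP x; rewrite -padic_class0 => u0.
have {}u0 : u \notin nullQ.
  by apply: contra u0 => u0; apply/eqP/padic_class_eq; rewrite subr0.
have [r r0 [N uN]] := cauchyQ_norm_stab u0.
by exists u, N; rewrite (padic_norm_stab uN).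
Qed.

Lemma padic_norm_lt (x : padic) e : padic_norm x < e ->
  forall u, x = padic_class u ->
  exists N, forall n, (N <= n)%N -> normQ p (u n) < e.
Proof.
move=> xe u xu; have [u0|u0] := boolP (u \in nullQ).
  have x0 : x = 0.
    by rewrite xu -padic_class0; apply/padic_class_eq; rewrite subr0.
  by move: xe; rewrite x0 padic_norm0; exact: (nullQP _ u0).
have [r r0 [N uN]] := cauchyQ_norm_stab u0.
by exists N => n Nn; rewrite uN // -(padic_norm_stab uN) -xu.
Qed.

Lemma padic_norm_ge0 x : 0 <= padic_norm x.
Proof.
have [->|x0] := eqVneq x 0; first by rewrite padic_norm0.
by have [u [N [_ /ltW]]] := padic_norm_neq0 x0.
Qed.

Lemma padic_norm_eq0 x : (padic_norm x == 0) = (x == 0).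
Proof.
have [->|x0] := eqVneq x 0; first by rewrite padic_norm0 eqxx.
by have [u [N [_ /lt0r_neq0/negbTE]]] := padic_norm_neq0 x0.
Qed.

Lemma padic_normN x : padic_norm (- x) = padic_norm x.
Proof.
have [->|x0] := eqVneq x 0; first by rewrite oppr0.
have [u [N [-> _ uN]]] := padic_norm_neq0 x0.
rewrite -padic_classN; apply: (padic_norm_stab (N := N)) => n Nn.
by rewrite -[X in normQ p X]/(- u n) normQN uN.
Qed.

Lemma padic_normD x y :
  padic_norm (x + y) <= Num.max (padic_norm x) (padic_norm y).
Proof.
rewrite leNgt; apply/negP; rewrite gt_max => /andP[xt yt].
have t0 : x + y != 0.
  by rewrite -padic_norm_eq0 lt0r_neq0 // (le_lt_trans (padic_norm_ge0 x)).
have [u xu] := padic_classP x; have [v yv] := padic_classP y.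
have [N uN] := padic_norm_lt xt xu; have [M vM] := padic_norm_lt yt yv.
have [w0|w0] := boolP (u + v \in nullQ).
  by move/eqP: t0; apply; rewrite xu yv -padic_classD -padic_class0;
     apply/padic_class_eq; rewrite subr0.
have [r r0 [K wK]] := cauchyQ_norm_stab w0.
have er : padic_norm (x + y) = r.
  by rewrite xu yv -padic_classD (padic_norm_stab wK).
pose n := maxn N (maxn M K).
have nN : (N <= n)%N by rewrite leq_maxl.
have nM : (M <= n)%N by rewrite leq_max leq_maxl orbT.
have nK : (K <= n)%N by rewrite leq_max leq_maxr orbT.
have := normQ_lt_add pr (uN n nN) (vM n nM).
by rewrite er -(wK n nK) ltxx.
Qed.

Lemma padic_normM x y : padic_norm (x * y) = padic_norm x * padic_norm y.
Proof.
have [->|x0] := eqVneq x 0; first by rewrite mul0r padic_norm0 mul0r.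
have [->|y0] := eqVneq y 0; first by rewrite mulr0 padic_norm0 mulr0.
have [u [N [ex _ uN]]] := padic_norm_neq0 x0.
have [v [M [ey _ vM]]] := padic_norm_neq0 y0.
rewrite {1}ex {1}ey -padic_classM.
apply: (padic_norm_stab (N := maxn N M)) => n; rewrite geq_max => /andP[Nn Mn].
by rewrite -[X in normQ p X]/(u n * v n) normQM // uN // vM.
Qed.

Definition padic_dist (x y : padic) : rat := padic_norm (x - y).

Lemma padic_distxx x : padic_dist x x = 0.
Proof. by rewrite /padic_dist subrr padic_norm0. Qed.

Lemma padic_dist_eq0 x y : padic_dist x y = 0 -> x = y.
Proof. by move/eqP; rewrite padic_norm_eq0 subr_eq0 => /eqP. Qed.

Lemma padic_distC x y : padic_dist x y = padic_dist y x.
Proof. by rewrite /padic_dist -padic_normN opprB. Qed.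

Lemma padic_dist_triangle y x z :
  padic_dist x z <= padic_dist x y + padic_dist y z.
Proof.
rewrite /padic_dist; have := padic_normD (x - y) (y - z).
rewrite addrA subrK => /le_trans; apply.
by rewrite ge_max lerDl lerDr !padic_norm_ge0.
Qed.

HB.instance Definition _ := isMetric.Build rat padic
  padic_distxx padic_dist_eq0 padic_distC padic_dist_triangle.
HB.instance Definition _ := isPointed.Build padic 0.

Lemma cauchyQ_const (q : rat) : (fun=> q) \in cauchyQ pr.
Proof.
by apply/cauchyQP => e e0; exists 0%N => m n _ _; rewrite subrr normQ0.
Qed.

Lemma padic_ratrE q : ratr q = padic_class (CauchySeq (cauchyQ_const q)).
Proof.
pose h q' := padic_class (CauchySeq (cauchyQ_const q')).
have hB : zmod_morphism h.
  move=> x y; rewrite /h -padic_classN -padic_classD; congr padic_class.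
  exact: val_inj.
have hM : monoid_morphism h.
  split=> [|x y]; first by rewrite -padic_class1; congr padic_class; exact: val_inj.
  by rewrite /h -padic_classM; congr padic_class; exact: val_inj.
pose hBi := GRing.isZmodMorphism.Build _ _ h hB.
pose hMi := GRing.isMonoidMorphism.Build _ _ h hM.
pose H : {rmorphism rat -> padic} := HB.pack h hBi hMi.
by rewrite -(fmorph_eq_rat H).
Qed.

Lemma padic_norm_ratr q : padic_norm (ratr q) = normQ p q.
Proof. by rewrite padic_ratrE; apply: (padic_norm_stab (N := 0)). Qed.

End Completion.

Section Schneider.
Context (p : nat) (pr : prime p).
Local Notation Qp := (padic pr).
Implicit Types x : Qp.

Definition padic_eps x : Qp := if x == 0 then 1 else ratr (padic_norm x) * x.

(* Junk value 0 outside Z_p. *)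
Definition padic_floor x : nat :=
  if [pick k : 'I_p | padic_norm (x - (k : nat)%:R) < 1] is Some k
  then k else 0%N.

(* Schneider's continued fraction map tau. *)
Definition schneider x : Qp :=
  (padic_eps x)^-1 - (padic_floor (padic_eps x)^-1)%:R.

(* The map f; its series converges for every x, so [limn] is its actual sum. *)
Definition schneider_sum x : Qp :=
  limn (series (fun n : nat =>
    (padic_floor (padic_eps (iter n schneider x))^-1)%:R *
    \prod_(0 <= m < n.+1)
      (iter m schneider x / padic_eps (iter m schneider x)))).

Definition padicQ : set Qp := range ratr.

(* Z[1/p], viewed in Q and then in Q_p. *)
Definition padicZV : set Qp :=
  ratr @` [set q : rat | exists (a : int) (n : nat), q = a%:~R / p%:R ^+ n].

End Schneider.

Arguments padicQ {p} pr.
Arguments padicZV {p} pr.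
Arguments schneider_sum {p} pr.

(* Main.v *)
From HB Require Import structures.
Require Import Defs.
From mathcomp Require Import all_boot all_order all_algebra.
From mathcomp Require Import all_classical all_reals all_analysis.
From mathcomp Require Import ring zify.
Set Implicit Arguments. Unset Strict Implicit. Unset Printing Implicit Defensive.
Import Order.TTheory GRing.Theory Num.Theory.
Local Open Scope classical_set_scope.
Local Open Scope ring_scope.

(* Write d(x) for the digit floor(1/eps(x)), so that x = p^v(x) / (d(x) +     *)
(* tau(x)) and f(x) = p^v(x) (d(x) + f(tau(x))). Hence |f(x)| = |x|, f(p^j x) *)
(* = p^j f(x), and f(x) determines v(x), d(x) and f(tau(x)); since x is a     *)
(* contracting function of tau(x), f is injective. It remains to see f(Q) =   *)
(* Z[1/p]. For integers r, s with p not dividing s, f(r/s) is an integer by   *)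
(* induction on |s| + p|r| + |r + s|: when p does not divide r, tau(r/s) = p  *)
(* t/r with s = d r + p t, which decreases this quantity unless r/s = -1,     *)
(* where f(-1) = -1. Conversely an integer m prime to p is d + p m' with 0 <  *)
(* d < p and |m'| < |m| unless m = -1, so if m' = f(q) with q rational, then  *)
(* m = f(1 / (d + p q)).                                                      *)

(* Unification must not unfold the [xget] and quotient constructions below.   *)
Opaque padic_norm padic_inv padic_class ratr.

(** * p-adic norms *)

(** The analytic half rests on [schneider_sum_rec], which follows from the rational partial sums and
    the geometric bound [partial_sum_tail]. It gives preservation of the norm
    ([padic_norm_schneider_sum]), injectivity ([schneider_sum_inj], through the contraction estimate
    [schneider_sum_eq_dist]) and homogeneity under powers of p ([schneider_sum_exprz]). The
    arithmetic half is a pair of descents on integers, [schneider_sum_frac] and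
    [schneider_sum_onto_int]; factoring out powers of p turns them into the two inclusions
    [schneider_sum_rat] and [schneider_sum_onto]. Injectivity then gives the equivalence: a point
    with value in Z[1/p] shares that value with a rational, hence is that rational. *)

Section PadicNorm.
Context (p : nat) (pr : prime p).
Local Notation Qp := (padic pr).
Implicit Types (x y z u : Qp) (m : int) (k : nat).

Lemma p_gt0 : 0 < p%:R :> rat. Proof. by rewrite ltr0n prime_gt0. Qed.
Lemma p_neq0 : p%:R != 0 :> rat. Proof. exact/lt0r_neq0/p_gt0. Qed.
Lemma p_gt1 : 1 < p%:R :> rat. Proof. by rewrite ltr1n prime_gt1. Qed.

(* [ratr] carries a canonical morphism structure only over a numFieldType,    *)
(* hence this copy.                                                           *)
Definition ratp (q : rat) : Qp := ratr q.

Fact ratp_is_zmod_morphism : zmod_morphism ratp.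
Proof.
move=> a b; rewrite /ratp !padic_ratrE -padic_classN -padic_classD.
by congr padic_class; exact: val_inj.
Qed.

Fact ratp_is_monoid_morphism : monoid_morphism ratp.
Proof.
rewrite /ratp; split=> [|a b].
  by rewrite padic_ratrE -padic_class1; congr padic_class; exact: val_inj.
by rewrite !padic_ratrE -padic_classM; congr padic_class; exact: val_inj.
Qed.

HB.instance Definition _ :=
  GRing.isZmodMorphism.Build rat Qp ratp ratp_is_zmod_morphism.
HB.instance Definition _ :=
  GRing.isMonoidMorphism.Build rat Qp ratp ratp_is_monoid_morphism.

Lemma padic_norm_ratp q : padic_norm (ratp q) = normQ p q.
Proof. exact: padic_norm_ratr. Qed.

Lemma normQ_int m : m != 0 -> normQ p m%:~R = p%:R ^- logn p `|m|.
Proof.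
move=> m0; rewrite /normQ intr_eq0 (negbTE m0) /valQ numq_int denq_int /=.
by rewrite logn1 subr0 exprnN.
Qed.

Lemma normQ_int_le1 m : normQ p m%:~R <= 1.
Proof.
have [->|m0] := eqVneq m 0; first by rewrite normQ0.
by rewrite normQ_int // invf_le1 ?exprn_gt0 ?p_gt0 // exprn_ege1 // ltW ?p_gt1.
Qed.

Lemma normQ_int_lt1 m : (normQ p m%:~R < 1) = (p %| m)%Z.
Proof.
have [->|m0] := eqVneq m 0; first by rewrite normQ0 ltr01 dvdz0.
rewrite normQ_int // invf_lt1 ?exprn_gt0 ?p_gt0 // dvdzE /=.
rewrite -[p in RHS]expn1 pfactor_dvdn ?absz_gt0 //.
by case: logn => [|l]; rewrite ?expr0 ?ltxx // exprn_egt1 ?p_gt1.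
Qed.

Lemma normQ_p : normQ p p%:R = p%:R^-1.
Proof.
have p0 : (p : int) != 0 by rewrite -lt0n prime_gt0.
by rewrite -[p%:R]/((Posz p)%:~R) (normQ_int p0) logn_prime // eqxx expr1.
Qed.

Lemma normQ_exprz (j : int) : normQ p (p%:R ^ j) = p%:R ^ (- j).
Proof.
have hX n : normQ p (p%:R ^+ n) = p%:R ^- n.
  elim: n => [|n IH]; first by rewrite !expr0 invr1 normQ1.
  by rewrite !exprS normQM // IH normQ_p invfM.
by case: j => n; rewrite ?NegzE -?exprnN ?opprK /= ?normQV // hX ?invrK // exprnN.
Qed.

Lemma padic_norm1 : padic_norm (1 : Qp) = 1.
Proof. by rewrite -(rmorph1 ratp) padic_norm_ratp normQ1. Qed.

Lemma padic_normV x : padic_norm x^-1 = (padic_norm x)^-1.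
Proof.
have [->|x0] := eqVneq x 0; first by rewrite invr0 padic_norm0 invr0.
apply: (mulIf (x := padic_norm x)); first by rewrite padic_norm_eq0.
by rewrite -padic_normM !mulVf ?padic_norm_eq0 // padic_norm1.
Qed.

Lemma padic_norm_nat k : padic_norm (k%:R : Qp) = normQ p k%:R.
Proof. by rewrite -(rmorph_nat ratp) padic_norm_ratp. Qed.

Lemma padic_distB x y : padic_norm (x - y) = padic_norm (y - x).
Proof. by rewrite -padic_normN opprB. Qed.

Lemma padic_norm_le_add (e : rat) x y :
  padic_norm x <= e -> padic_norm y <= e -> padic_norm (x + y) <= e.
Proof. by move=> hx hy; apply: le_trans (padic_normD x y) _; rewrite ge_max hx. Qed.

Lemma padic_norm_lt_add (e : rat) x y :
  padic_norm x < e -> padic_norm y < e -> padic_norm (x + y) < e.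
Proof.
by move=> hx hy; apply: le_lt_trans (padic_normD x y) _; rewrite gt_max hx.
Qed.

Lemma padic_normD_dominant x y :
  padic_norm y < padic_norm x -> padic_norm (x + y) = padic_norm x.
Proof.
move=> yx; apply/eqP; rewrite eq_le padic_norm_le_add ?(ltW yx) //=.
rewrite leNgt; apply/negP => h; have : padic_norm (x + y - y) < padic_norm x.
  by rewrite padic_norm_lt_add ?padic_normN.
by rewrite addrK ltxx.
Qed.

Lemma padic_norm_exprz x : x != 0 -> exists j : int, padic_norm x = p%:R ^ j.
Proof.
move=> x0; have [u [N [ex nx uN]]] := padic_norm_neq0 x0.
exists (- valQ p (u N)); rewrite -(uN N (leqnn N)) /normQ ifN //.
by rewrite -(normQ_eq0 pr) uN // lt0r_neq0.
Qed.

(** A nonzero norm is a power p^j, whose own p-adic norm is p^-j. This is what makes [padic_eps x] a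
    unit. *)
Lemma normQ_padic_norm x : normQ p (padic_norm x) = (padic_norm x)^-1.
Proof.
have [->|x0] := eqVneq x 0; first by rewrite padic_norm0 normQ0 ?invr0.
by have [j ->] := padic_norm_exprz x0; rewrite normQ_exprz -invr_expz.
Qed.

(** The value group is discrete. Applied to [schneider x], this gains a factor 1/p at each
    iteration. *)
Lemma padic_norm_lt1 x : padic_norm x < 1 -> padic_norm x <= p%:R^-1.
Proof.
have [->|x0] := eqVneq x 0.
  by rewrite padic_norm0 invr_ge0 ltW ?p_gt0.
have [j ->] := padic_norm_exprz x0.
rewrite -[X in _ < X](expr0z p%:R) -exprN1 !(ltr_eXz2l, ler_eXz2l) ?p_gt1 //.
Qed.

(** Stands in for a passage to the limit, both in the functional equation and in injectivity. *)
Lemma padic_norm_small_eq0 (C : rat) x :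
  (forall n, padic_norm x <= C * p%:R ^- n) -> x = 0.
Proof.
move=> h; apply/eqP; rewrite -padic_norm_eq0; apply/negPn/negP => x0.
have xgt : 0 < padic_norm x by rewrite lt_def x0 padic_norm_ge0.
pose n := Num.bound `|C / padic_norm x|.
have Cn : C / padic_norm x < p%:R ^+ n.
  apply: lt_trans (_ : _ < n%:R) _.
    exact: le_lt_trans (ler_norm _) (archi_boundP (normr_ge0 _)).
  by rewrite -natrX ltr_nat ltn_expl // prime_gt1.
have := h n; rewrite ler_pdivlMr ?exprn_gt0 ?p_gt0 // leNgt => /negP[].
by rewrite mulrC -ltr_pdivrMr.
Qed.

End PadicNorm.

(** * Digits *)

Section Schneider.
Context (p : nat) (pr : prime p).
Local Notation Qp := (padic pr).
Local Notation ratp := (@ratp p pr).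
Implicit Types (x y z u : Qp) (m : int) (k n : nat).

Lemma padic_class_approx (s : cauchy_seq pr) (e : rat) : 0 < e ->
  exists N, forall n, (N <= n)%N -> padic_norm (padic_class s - ratp (s n)) < e.
Proof.
move=> e0; have [N sN] := cauchyQP pr _ (valP s) _ e0; exists N => n Nn.
rewrite /ratp padic_ratrE -padic_classN -padic_classD.
set v := s - _; have vN i : (N <= i)%N -> normQ p (v i) < e.
  by move=> Ni; apply: sN.
have [v0|v0] := boolP (v \in @nullQ p pr).
  suff -> : padic_class v = 0 by rewrite padic_norm0.
  by rewrite -padic_class0; apply/padic_class_eq; rewrite subr0.
have [r r0 [M vM]] := cauchyQ_norm_stab v0.
rewrite (padic_norm_stab vM) -(vM (maxn N M)) ?leq_maxr // vN //.
exact: leq_maxl.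
Qed.

Lemma padic_rat_dense x (e : rat) : 0 < e -> exists q, padic_norm (x - ratp q) < e.
Proof.
move=> e0; have [s ->] := padic_classP x.
by have [N sN] := padic_class_approx s e0; exists (s N); apply: sN.
Qed.

Lemma normQ_le1_den (q : rat) : normQ p q <= 1 -> ~~ (p %| denq q)%Z.
Proof.
apply: contraTN => pd; rewrite -ltNge.
have pn : ~~ (p %| numq q)%Z.
  apply/negP => pn; have := coprime_num_den q.
  rewrite /coprime => /eqP/(congr1 (dvdn p)).
  move: pn pd; rewrite !dvdzE dvdn_gcd /= => -> -> /esym.
  by rewrite dvdn1 => /eqP p1; move: pr; rewrite p1.
have d0 : 0 < normQ p (denq q)%:~R.
  by rewrite lt_def normQ_eq0 // intr_eq0 denq_neq0 normQ_ge0.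
have n1 : normQ p (numq q)%:~R = 1.
  apply/eqP; rewrite eq_le normQ_int_le1 //= leNgt.
  by rewrite normQ_int_lt1.
by rewrite -(divq_num_den q) normQM // normQV // n1 mul1r invf_gt1 // normQ_int_lt1.
Qed.

Lemma normQ_residue (q : rat) : normQ p q <= 1 ->
  exists2 k, (k < p)%N & normQ p (q - k%:R) < 1.
Proof.
move=> /normQ_le1_den pd.
have p0 : (p : int) != 0 by rewrite -lt0n prime_gt0.
have : coprimez (denq q) p.
  rewrite coprimez_sym /coprimez; rewrite -[gcdz _ _]/(Posz (gcdn _ _)).
  by rewrite eqz_nat -/(coprime _ _) prime_coprime.
move=> /coprimezP[[a b]] /= ab.
have kE := modz_ge0 (numq q * a) p0.
(* The Bezout coefficient [a] inverts the denominator modulo p, so [numq q * a] represents the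
   residue of [q]. *)
exists `|((numq q * a) %% p)%Z|%N.
  by rewrite -ltz_nat gez0_abs // ltz_pmod // ltz_nat prime_gt0.
set k := `|_|%N.
have kz : (k : int) = ((numq q * a) %% p)%Z by rewrite gez0_abs.
have -> : q - k%:R = (numq q - k%:Z * denq q)%:~R / (denq q)%:~R.
  by rewrite rmorphB rmorphM /= mulrBl divq_num_den mulfK ?intr_eq0 ?denq_neq0.
have d1 : normQ p (denq q)%:~R = 1.
  by apply/eqP; rewrite eq_le normQ_int_le1 //= leNgt normQ_int_lt1.
rewrite normQM // normQV // d1 invr1 mulr1 normQ_int_lt1 //.
have -> : numq q - k%:Z * denq q
    = (numq q * b + ((numq q * a) %/ p)%Z * denq q) * p.
  have := divz_eq (numq q * a) p; rewrite -kz => e.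
  have -> : (k : int) = numq q * a - ((numq q * a) %/ p)%Z * p.
    by rewrite {1}e; ring.
  by rewrite -[X in X - _]mulr1 -ab; ring.
exact: dvdz_mull.
Qed.

Lemma padic_norm_nat_lt1 k : (padic_norm (k%:R : Qp) < 1) = (p %| k)%N.
Proof. by rewrite padic_norm_nat -[k%:R]/((k : int)%:~R) normQ_int_lt1. Qed.

Lemma padic_norm_nat_le1 k : padic_norm (k%:R : Qp) <= 1.
Proof. by rewrite padic_norm_nat -[k%:R]/((k : int)%:~R) normQ_int_le1. Qed.

Lemma padic_norm_digit k : (0 < k < p)%N -> padic_norm (k%:R : Qp) = 1.
Proof.
move=> /andP[k0 kp]; apply/eqP; rewrite eq_le padic_norm_nat_le1 leNgt.
by rewrite padic_norm_nat_lt1 gtnNdvd.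
Qed.

Lemma residue_uniq u k l : (k < p)%N -> (l < p)%N ->
  padic_norm (u - k%:R) < 1 -> padic_norm (u - l%:R) < 1 -> k = l.
Proof.
wlog kl : k l / (k <= l)%N => [H kp lp hk hl|kp lp hk hl].
  by case: (leqP k l) => [|/ltnW] kl; [|apply/esym]; apply: H kl _ _ _ _.
have : padic_norm ((l - k)%N%:R : Qp) < 1.
  rewrite natrB // (_ : _ - _ = (u - k%:R) - (u - l%:R)); last by ring.
  by rewrite padic_norm_lt_add ?padic_normN.
rewrite padic_norm_nat_lt1 => /dvdn_leq; lia.
Qed.

Lemma padic_floor_uniq u k : (k < p)%N ->
  padic_norm (u - k%:R) < 1 -> padic_floor u = k.
Proof.
move=> kp hk; rewrite /padic_floor; case: pickP => [l hl|/(_ (Ordinal kp))].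
  exact: residue_uniq hl hk.
by rewrite /= hk.
Qed.

(** A rational within distance less than 1 of [u] has the same residue, so the default value in
    [padic_floor] never arises on Z_p. *)
Lemma padic_floorP u : padic_norm u <= 1 ->
  (padic_floor u < p)%N /\ padic_norm (u - (padic_floor u)%:R) < 1.
Proof.
move=> u1; have [q uq] := padic_rat_dense u ltr01.
have q1 : normQ p q <= 1.
  rewrite -(padic_norm_ratp pr) -[ratp _](subKr u).
  by apply: padic_norm_le_add; rewrite ?padic_normN // ltW.
have [k kp qk] := normQ_residue q1.
suff uk : padic_norm (u - k%:R) < 1 by rewrite (padic_floor_uniq kp uk).
rewrite -[u](subrK (ratp q)) -addrA padic_norm_lt_add //.
by rewrite -(rmorph_nat ratp) -rmorphB padic_norm_ratp.
Qed.

Definition digit x : nat := padic_floor (padic_eps x)^-1.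
(** This is p^v(x); at 0 the convention 0^-1 = 0 agrees with 0/eps(0) = 0. *)
Definition scale x : rat := (padic_norm x)^-1.

Lemma padic_norm_eps x : padic_norm (padic_eps x) = 1.
Proof.
rewrite /padic_eps; case: eqVneq => [_|x0]; first exact: padic_norm1.
rewrite padic_normM padic_norm_ratr normQ_padic_norm mulVf //.
by rewrite padic_norm_eq0.
Qed.

Lemma padic_eps_neq0 x : padic_eps x != 0.
Proof. by rewrite -padic_norm_eq0 padic_norm_eps oner_eq0. Qed.

Lemma padic_div_eps x : x / padic_eps x = ratp (scale x).
Proof.
rewrite /padic_eps; case: eqVneq => [->|x0].
  by rewrite mul0r /scale padic_norm0 invr0 rmorph0.
rewrite invfM mulrCA divff // mulr1 /scale fmorphV //.
Qed.

Lemma digit_schneider x : (padic_eps x)^-1 = (digit x)%:R + schneider x.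
Proof. by rewrite /schneider addrC subrK. Qed.

Lemma scale_schneider x : x = ratp (scale x) / ((digit x)%:R + schneider x).
Proof. by rewrite -digit_schneider invrK -padic_div_eps divfK ?padic_eps_neq0. Qed.

Lemma padic_norm_schneider_lt1 x : padic_norm (schneider x) < 1.
Proof.
by have [] := @padic_floorP (padic_eps x)^-1;
   rewrite // padic_normV padic_norm_eps invr1.
Qed.

Lemma digit_ltp x : (digit x < p)%N.
Proof.
by have [] := @padic_floorP (padic_eps x)^-1;
   rewrite // padic_normV padic_norm_eps invr1.
Qed.

Lemma digit_gt0 x : (0 < digit x)%N.
Proof.
rewrite lt0n; apply/eqP => d0; have := padic_norm_schneider_lt1 x.
rewrite /schneider -/(digit x) d0 subr0 padic_normV padic_norm_eps invr1.
by rewrite ltxx.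
Qed.

Lemma padic_norm_digit1 x : padic_norm ((digit x)%:R : Qp) = 1.
Proof. by rewrite padic_norm_digit // digit_gt0 digit_ltp. Qed.

Lemma padic_norm_digitD x z : padic_norm z < 1 ->
  padic_norm ((digit x)%:R + z) = 1.
Proof. by move=> z1; rewrite padic_normD_dominant padic_norm_digit1. Qed.

Lemma padic_norm_scale x : padic_norm (ratp (scale x)) = padic_norm x.
Proof. by rewrite padic_norm_ratp normQV // normQ_padic_norm invrK. Qed.

End Schneider.

(** * The sum f and its functional equation *)

Lemma subr_div_same_num (F : fieldType) (s a b : F) : a != 0 -> b != 0 ->
  s / a - s / b = s * (b - a) / (a * b).
Proof. by move=> a0 b0; field; rewrite a0 b0. Qed.

Section SchneiderSum.
Context (p : nat) (pr : prime p).
Local Notation Qp := (padic pr).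
Local Notation ratp := (@ratp p pr).
Implicit Types (x y z u : Qp) (m : int) (k n : nat).
Local Notation f := (schneider_sum pr).
Local Notation tau := (@schneider p pr).

(** Every term of the series is rational, so the partial sums are themselves a Cauchy sequence in
    [rat] representing the limit. *)
Definition partial_sum n x : rat := \sum_(0 <= i < n)
  (digit (iter i tau x))%:R * \prod_(0 <= j < i.+1) scale (iter j tau x).

Lemma partial_sumS n x :
  partial_sum n.+1 x = scale x * ((digit x)%:R + partial_sum n (tau x)).
Proof.
rewrite /partial_sum big_nat_recl //= big_nat1 mulrDr [_%:R * _]mulrC; congr (_ + _).
rewrite mulr_sumr; apply: eq_bigr => i _.
rewrite -iterS iterSr mulrCA [in LHS]big_nat_recl //=; congr (_ * (_ * _)).
by apply: eq_bigr => j _; rewrite -iterS iterSr.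
Qed.

Lemma partial_sumE x :
  schneider_sum pr x = limn (fun n => ratp (partial_sum n x)).
Proof.
rewrite /schneider_sum; congr (limn _); apply/funext => n.
rewrite /series /= /partial_sum rmorph_sum; apply: eq_bigr => i _.
rewrite rmorphM rmorph_nat rmorph_prod; congr (_ * _).
by apply: eq_bigr => j _; rewrite padic_div_eps.
Qed.

(** By [partial_sumS] both sums have the same leading digit, which cancels; what remains is the same
    difference at [tau x], times [scale x]. As |tau(x)| <= 1/p, each step gains a factor 1/p. The
    case [n = 0] holds because digit plus tail is a unit. *)
Lemma partial_sum_tail n k x :
  padic_norm (ratp (partial_sum (n + k) x - partial_sum n x))
    <= padic_norm x * p%:R ^- n.
Proof.
elim: n x k => [|n IH] x k.
  rewrite add0n expr0 invr1 mulr1 {2}/partial_sum big_nil subr0.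
  elim: k x => [|k IHk] x.
    by rewrite /partial_sum big_nil rmorph0 padic_norm0 padic_norm_ge0.
  rewrite partial_sumS rmorphM rmorphD rmorph_nat padic_normM padic_norm_scale.
  rewrite padic_norm_digitD ?mulr1 //.
  exact: le_lt_trans (IHk _) (padic_norm_schneider_lt1 _).
rewrite addSn !partial_sumS -mulrBr opprD addrACA subrr add0r.
rewrite rmorphM padic_normM padic_norm_scale.
rewrite ler_wpM2l ?padic_norm_ge0 //; apply: le_trans (IH _ _) _.
rewrite exprS invfM ler_wpM2r ?invr_ge0 ?exprn_ge0 ?ler0n //.
exact/padic_norm_lt1/padic_norm_schneider_lt1.
Qed.

Lemma expVn_small (C e : rat) : 0 < e -> exists N, forall n, (N <= n)%N ->
  C * p%:R ^- n < e.
Proof.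
move=> e0; exists (Num.bound `|C / e|) => n Nn.
rewrite ltr_pdivrMr ?exprn_gt0 ?p_gt0 // mulrC -ltr_pdivrMr //.
apply: le_lt_trans (ler_norm _) _; apply: lt_le_trans (archi_boundP (normr_ge0 _)) _.
rewrite -natrX ler_nat (leq_trans Nn) // ltnW // ltn_expl // prime_gt1 //.
Qed.

Lemma partial_sum_cauchy x : (fun n => partial_sum n x) \in cauchyQ pr.
Proof.
apply/cauchyQP => e e0; have [N hN] := expVn_small (padic_norm x) e0.
exists N => m n Nm Nn; rewrite -(padic_norm_ratp pr).
wlog mn : m n Nm Nn / (n <= m)%N => [H|].
  by case: (leqP n m) => [|/ltnW] nm; [|rewrite -opprB rmorphN padic_normN]; apply: H.
rewrite -(subnKC mn); exact: le_lt_trans (partial_sum_tail _ _ _) (hN _ Nn).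
Qed.

Lemma schneider_sum_class x : f x = padic_class (CauchySeq (partial_sum_cauchy x)).
Proof.
rewrite partial_sumE; apply: cvg_lim; first exact: metric_hausdorff.
apply/cvg_ballP => e e0.
have [N hN] := padic_class_approx (CauchySeq (partial_sum_cauchy x)) e0.
by exists N => // n /= Nn; apply: hN.
Qed.

Lemma schneider_sum_approx x n :
  padic_norm (f x - ratp (partial_sum n x)) <= padic_norm x * p%:R ^- n.
Proof.
rewrite leNgt; apply/negP => h.
have e0 : 0 < padic_norm (f x - ratp (partial_sum n x)).
  apply: le_lt_trans h.
  by rewrite mulr_ge0 ?padic_norm_ge0 ?invr_ge0 ?exprn_ge0 ?ler0n.
have [N hN] := padic_class_approx (CauchySeq (partial_sum_cauchy x)) e0.
(* A late partial sum is closer to f(x) than the supposed distance, and by the tail bound also that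
   close to the [n]-th one: the ultrametric inequality is violated. *)
have := hN (n + N)%N (leq_addl _ _); rewrite -schneider_sum_class /= => hx.
have := padic_norm_lt_add hx (le_lt_trans (partial_sum_tail n N x) h).
by rewrite rmorphB addrA subrK ltxx.
Qed.

Lemma padic_norm_schneider_sum_le x : padic_norm (f x) <= padic_norm x.
Proof.
have := schneider_sum_approx x 0.
by rewrite /partial_sum big_nil rmorph0 subr0 expr0 invr1 mulr1.
Qed.

Lemma schneider_sum_rec x : f x = ratp (scale x) * ((digit x)%:R + f (tau x)).
Proof.
apply/eqP; rewrite -subr_eq0; apply/eqP.
apply: (@padic_norm_small_eq0 _ _ (padic_norm x)) => n.
set s := partial_sum n (tau x).
have -> : f x - ratp (scale x) * ((digit x)%:R + f (tau x))
  = (f x - ratp (partial_sum n.+1 x)) - ratp (scale x) * (f (tau x) - ratp s).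
  by rewrite partial_sumS rmorphM rmorphD rmorph_nat -/s; ring.
have pn0 : 0 <= (p%:R ^- n : rat) by rewrite invr_ge0 exprn_ge0 ?ler0n.
apply: padic_norm_le_add.
  apply: le_trans (schneider_sum_approx x n.+1) _.
  rewrite ler_wpM2l ?padic_norm_ge0 // exprS invfM ler_piMl //.
  by rewrite invf_le1 ?p_gt0 // ltW ?p_gt1.
rewrite padic_normN padic_normM padic_norm_scale ler_wpM2l ?padic_norm_ge0 //.
apply: le_trans (schneider_sum_approx _ _) _.
by rewrite ler_piMl // ltW ?padic_norm_schneider_lt1.
Qed.

Lemma padic_norm_schneider_sum_tau_lt1 x : padic_norm (f (tau x)) < 1.
Proof.
exact: le_lt_trans (padic_norm_schneider_sum_le _) (padic_norm_schneider_lt1 _).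
Qed.

Lemma padic_norm_schneider_sum x : padic_norm (f x) = padic_norm x.
Proof.
rewrite schneider_sum_rec padic_normM padic_norm_scale padic_norm_digitD ?mulr1 //.
exact: padic_norm_schneider_sum_tau_lt1.
Qed.

Lemma schneider_sum0 : f 0 = 0.
Proof.
by apply/eqP; rewrite -padic_norm_eq0 padic_norm_schneider_sum padic_norm0.
Qed.

(** * Injectivity and homogeneity *)

(** Equal values force equal norms, equal digits and f(tau(x)) = f(tau(y)). Since x = p^v/(d +
    tau(x)) with unit denominator, |x - y| = |x| |tau(x) - tau(y)|, and induction applies to the
    second factor. *)
Lemma schneider_sum_eq_dist x y n : f x = f y ->
  padic_norm (x - y) <= padic_norm x * p%:R ^- n.
Proof.
elim: n x y => [|n IH] x y fxy.
all: have nxy : padic_norm x = padic_norm y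
  by rewrite -(padic_norm_schneider_sum x) fxy padic_norm_schneider_sum.
  by rewrite expr0 invr1 mulr1 padic_norm_le_add // padic_normN nxy.
have [x0|x0] := eqVneq x 0.
  have -> : y = 0 by apply/eqP; rewrite -padic_norm_eq0 -nxy x0 padic_norm0.
  by rewrite x0 subrr padic_norm0 mul0r.
have sxy : scale x = scale y by rewrite /scale nxy.
have s0 : ratp (scale x) != 0.
  by rewrite -padic_norm_eq0 padic_norm_scale padic_norm_eq0.
have e : (digit x)%:R + f (tau x) = (digit y)%:R + f (tau y).
  move: fxy; rewrite [f x]schneider_sum_rec [f y]schneider_sum_rec -sxy.
  by move=> /(mulfI s0).
have dxy : digit x = digit y.
  (* Both digits are the residue of the common value [e], because |f(tau)| < 1. *)
  apply: (residue_uniq (digit_ltp x) (digit_ltp y) (u := (digit x)%:R + f (tau x))).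
    by rewrite [X in X - _]addrC addrK padic_norm_schneider_sum_tau_lt1.
  by rewrite e [X in X - _]addrC addrK padic_norm_schneider_sum_tau_lt1.
have {}e : f (tau x) = f (tau y) by move: e; rewrite dxy => /addrI.
have hx := padic_norm_digitD x (padic_norm_schneider_lt1 x).
have hy := padic_norm_digitD y (padic_norm_schneider_lt1 y).
have hx0 : (digit x)%:R + tau x != 0 by rewrite -padic_norm_eq0 hx oner_eq0.
have hy0 : (digit y)%:R + tau y != 0 by rewrite -padic_norm_eq0 hy oner_eq0.
have -> : x - y = ratp (scale x) * (tau y - tau x) /
    (((digit x)%:R + tau x) * ((digit y)%:R + tau y)).
  rewrite [x in LHS]scale_schneider [y in LHS]scale_schneider -sxy.
  move: hx0 hy0; rewrite dxy; set a := _ + _; set b := _ + _ => a0 b0.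
  have -> : tau y - tau x = b - a by rewrite /a /b; ring.
  exact: subr_div_same_num.
rewrite padic_normM padic_normV (padic_normM (ratp _)) (padic_normM (_ + _)).
rewrite hx hy mulr1 invr1 mulr1 padic_norm_scale.
apply: ler_wpM2l; first exact: padic_norm_ge0.
rewrite padic_distB; apply: le_trans (IH _ _ e) _.
rewrite exprS invfM; apply: ler_wpM2r; first by rewrite invr_ge0 exprn_ge0 ?ler0n.
exact/padic_norm_lt1/padic_norm_schneider_lt1.
Qed.

Lemma schneider_sum_inj : injective f.
Proof.
move=> x y fxy; apply/eqP; rewrite -subr_eq0; apply/eqP.
by apply: (@padic_norm_small_eq0 _ _ (padic_norm x)) => n; apply: schneider_sum_eq_dist.
Qed.

(** Multiplication by p^j leaves [padic_eps] unchanged, hence also the digit and [tau]; only the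
    factor [scale] is affected. *)
Lemma schneider_sum_exprz (j : int) x :
  f (ratp (p%:R ^ j) * x) = ratp (p%:R ^ j) * f x.
Proof.
have [->|x0] := eqVneq x 0; first by rewrite mulr0 schneider_sum0 mulr0.
set y := ratp _ * x.
have ny : padic_norm y = p%:R ^ (- j) * padic_norm x.
  by rewrite padic_normM padic_norm_ratp normQ_exprz.
have sy : scale y = p%:R ^ j * scale x by rewrite /scale ny invfM invr_expz opprK.
have y0 : y != 0.
  by rewrite -padic_norm_eq0 ny mulf_neq0 ?padic_norm_eq0 // expfz_neq0 // p_neq0.
have ey : padic_eps y = padic_eps x.
  rewrite /padic_eps (negbTE y0) (negbTE x0) -!/(ratp _) ny /y mulrA -rmorphM.
  by congr (ratp _ * x); rewrite mulrAC -expfzDr ?p_neq0 // addNr expr0z mul1r.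
rewrite (schneider_sum_rec y) (schneider_sum_rec x) sy rmorphM -mulrA.
by rewrite /schneider /digit ey.
Qed.

Lemma schneider_sum_unit u k : (k < p)%N -> padic_norm u = 1 ->
  padic_norm (u^-1 - k%:R) < 1 -> f u = k%:R + f (u^-1 - k%:R).
Proof.
move=> kp u1 uk; rewrite schneider_sum_rec /scale u1 invr1 rmorph1 mul1r.
have eu : padic_eps u = u.
  have u0 : u != 0 by rewrite -padic_norm_eq0 u1 oner_eq0.
  by rewrite /padic_eps (negbTE u0) u1 -/(ratp 1) rmorph1 mul1r.
by rewrite /schneider /digit eu (padic_floor_uniq kp uk).
Qed.

End SchneiderSum.

(** * Rational points *)

(** Removing a factor p from the numerator can raise the last summand by at most (p - 1)|t|, while
    the middle one drops by p(p - 1)|t|. *)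
Lemma frac_measure_mulp (p : nat) (s t : int) : (1 < p)%N -> t != 0 ->
  `|s| + p%:Z * `|t| + `|t + s| < `|s| + p%:Z * `|t * p| + `|t * p + s|.
Proof.
move=> p2 t0.
have tp : `|t * p| = p%:Z * `|t| by rewrite normrM mulrC.
have X2 : 2 * `|t| <= p%:Z * `|t| by rewrite ler_wpM2r.
have : 2 * (p%:Z * `|t|) <= p%:Z * (p%:Z * `|t|) by rewrite ler_wpM2r.
have : `|t * p - t| = p%:Z * `|t| - `|t|.
  have p1 : `|p%:Z - 1| = p%:Z - 1 by lia.
  have -> : t * p - t = (p%:Z - 1) * t by ring.
  by rewrite normrM p1; ring.
by rewrite tp; lia.
Qed.

(** Put A = |s + r| + (p - 1 - k)|r| > 0. From p(t + r) = (s + r) + (p - 1 - k)r comes |t + r| <=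
    A/p < A, and p|t| <= |s| + k|r| settles the rest. The summand |r + s| is what keeps the descent
    strict when k = p - 1. *)
Lemma frac_measure_step (p k : nat) (r s t : int) : (1 < p)%N -> (k < p)%N ->
  r != 0 -> s + r != 0 -> s - k%:Z * r = t * p ->
  `|r| + p%:Z * `|t| + `|t + r| < `|s| + p%:Z * `|r| + `|r + s|.
Proof.
move=> p2 kp r0 sr e.
have kr : `|k%:Z * r| = k%:Z * `|r| by rewrite normrM.
have tp : p%:Z * `|t| = `|t * p| by rewrite normrM mulrC.
have cr : `|(p%:Z - 1 - k%:Z) * r| = p%:Z * `|r| - `|r| - k%:Z * `|r|.
  have p1 : `|p%:Z - 1 - k%:Z| = p%:Z - 1 - k%:Z by lia.
  by rewrite normrM p1; ring.
have tr : p%:Z * `|t + r| = `|s + r + (p%:Z - 1 - k%:Z) * r|.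
  have -> : s + r + (p%:Z - 1 - k%:Z) * r = p%:Z * (t + r).
    have -> : s = t * p + k%:Z * r by rewrite -e subrK.
    by ring.
  by rewrite normrM.
have : 2 * `|t + r| <= p%:Z * `|t + r| by rewrite ler_wpM2r.
have := normr_ge0 ((p%:Z - 1 - k%:Z) * r).
rewrite tp tr -e; lia.
Qed.

Section RationalPoints.
Context (p : nat) (pr : prime p).
Local Notation Qp := (padic pr).
Local Notation ratp := (@ratp p pr).
Implicit Types (m r s t : int) (k n : nat) (q : rat).
Local Notation f := (schneider_sum pr).

Lemma normQ_int_unit m : ~~ (p %| m)%Z -> normQ p m%:~R = 1.
Proof.
by move=> pm; apply/eqP; rewrite eq_le normQ_int_le1 //= leNgt normQ_int_lt1.
Qed.

Lemma schneider_sum_mulp q : f (ratp (p%:R * q)) = ratp p%:R * f (ratp q).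
Proof. by rewrite rmorphM -[p%:R]expr1z schneider_sum_exprz. Qed.

Lemma schneider_sum_unit_rat q k : (k < p)%N -> normQ p q = 1 ->
  normQ p (q^-1 - k%:R) < 1 -> f (ratp q) = k%:R + f (ratp (q^-1 - k%:R)).
Proof.
move=> kp q1 qk; rewrite rmorphB rmorph_nat fmorphV.
apply: schneider_sum_unit => //; first by rewrite padic_norm_ratp.
by rewrite -(rmorph_nat ratp) -fmorphV -rmorphB padic_norm_ratp.
Qed.

(* tau(-1) = -p and tau(-p) = -p: this orbit, with all digits p - 1, is the     *)
(* only non-terminating behaviour of a rational.                                *)
Lemma schneider_sumN1 : f (ratp (-1)) = ratp (-1).
Proof.
have e : f (ratp (-1)) = (p.-1)%:R + ratp p%:R * f (ratp (-1)).
  have kE : (-1)^-1 - (p.-1)%:R = p%:R * (-1) :> rat.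
    rewrite invrN1 -[in RHS](prednK (prime_gt0 pr)) -natr1; ring.
  rewrite -schneider_sum_mulp -kE; apply: schneider_sum_unit_rat.
  - by rewrite prednK // prime_gt0.
  - by rewrite normQN // normQ1.
  - rewrite kE normQM // normQN // normQ1 mulr1 normQ_p // invf_lt1 ?p_gt1 //.
    exact: p_gt0.
(* By [e], f(-1) solves y = (p - 1) + p y; cancelling 1 - p leaves y = -1. *)
have p1 : ratp (1 - p%:R) != 0.
  rewrite -padic_norm_eq0 padic_norm_ratp normQ_eq0 // subr_eq0 eq_sym.
  by rewrite gt_eqF // p_gt1.
apply: (mulfI p1); rewrite -rmorphM mulrN1 opprB rmorphB rmorph1 mulrBl mul1r.
by rewrite {1}e addrK -(rmorph_nat ratp) -subn1 natrB ?prime_gt0.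
Qed.

Lemma schneider_sum_frac r s : ~~ (p %| s)%Z ->
  exists m, f (ratp (r%:~R / s%:~R)) = ratp m%:~R.
Proof.
have p2 := prime_gt1 pr.
have [N] := ubnP `|(`|s| + p%:Z * `|r| + `|r + s|)%R|%N.
elim: N r s => // N IH r s hN ps.
have s0 : s != 0 by apply: contraNneq ps => ->; rewrite dvdz0.
have [->|r0] := eqVneq r 0.
  by exists 0; rewrite mul0r !rmorph0 schneider_sum0.
have [/dvdzP[t rt]|pnr] := boolP (p %| r)%Z.
  have t0 : t != 0 by apply: contraNneq r0 => t0; rewrite rt t0 mul0r.
  have [|m hm] := IH t s _ ps.
    have := frac_measure_mulp s p2 t0; move: hN; rewrite rt; lia.
  exists (p%:Z * m).
  have -> : r%:~R / s%:~R = p%:R * (t%:~R / s%:~R) :> rat.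
    by rewrite rt intrM mulrAC mulrC.
  by rewrite schneider_sum_mulp hm intrM rmorphM.
(* The fraction is -1, the one case in which the measure does not decrease. *)
have [sr|sr] := eqVneq (s + r) 0.
  have -> : s = - r by apply/eqP; rewrite -addr_eq0 sr.
  exists (-1); rewrite rmorphN invrN mulrN divff ?intr_eq0 //.
  exact: schneider_sumN1.
have q1 : normQ p (r%:~R / s%:~R) = 1.
  by rewrite normQM // normQV // !normQ_int_unit // invr1 mulr1.
have qV1 : normQ p (r%:~R / s%:~R)^-1 <= 1 by rewrite normQV // q1 invr1.
have [k kp hk] := normQ_residue pr qV1.
have eq : (r%:~R / s%:~R)^-1 - k%:R = (s - k%:Z * r)%:~R / r%:~R :> rat.
  by rewrite invf_div intrB intrM mulrBl mulfK ?intr_eq0.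
have : (p %| s - k%:Z * r)%Z.
  rewrite -(normQ_int_lt1 pr); move: hk; rewrite eq normQM // normQV //.
  by rewrite [normQ p r%:~R]normQ_int_unit // invr1 mulr1.
move=> /dvdzP[t ht].
(* The old numerator [r] becomes the denominator, and it is prime to p as the induction requires. *)
have [|m hm] := IH t r _ pnr.
  have := frac_measure_step p2 kp r0 sr ht; move: hN; lia.
exists (k%:Z + p%:Z * m); rewrite (schneider_sum_unit_rat kp) // eq ht.
have -> : (t * p)%:~R / r%:~R = p%:R * (t%:~R / r%:~R) :> rat.
  by rewrite intrM mulrAC mulrC.
by rewrite schneider_sum_mulp hm intrD intrM rmorphD rmorphM -(rmorph_nat ratp k).
Qed.

Lemma schneider_sum_onto_int m : exists q, f (ratp q) = ratp m%:~R.
Proof.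
have p2 := prime_gt1 pr.
have [N] := ubnP `|m|%N.
elim: N m => // N IH m hN.
have [->|m0] := eqVneq m 0.
  by exists 0; rewrite !rmorph0 schneider_sum0.
have [/dvdzP[t mt]|pnm] := boolP (p %| m)%Z.
  have [|q hq] := IH t; first by move: hN; rewrite mt; nia.
  by exists (p%:R * q); rewrite schneider_sum_mulp hq mt intrM rmorphM mulrC.
have [->|m1] := eqVneq m (-1); first by exists (-1); apply: schneider_sumN1.
have p0 : (p : int) != 0 by rewrite -lt0n prime_gt0.
set k := `|(m %% p)%Z|%N.
have kz : (m %% p)%Z = k by rewrite gez0_abs // modz_ge0.
have kp : (k < p)%N by rewrite -ltz_nat -kz ltz_pmod // ltz_nat prime_gt0.
have k0 : (0 < k)%N.
  by rewrite lt0n; apply: contraNneq pnm => k0; apply/dvdz_mod0P; rewrite kz k0.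
have := divz_eq m p; rewrite kz; set t := (m %/ p)%Z => mE.
(* From [m = t * p + k] with 0 < k < p, the quotient satisfies |t| < |m| because m = -1 is
   excluded. *)
have [|q hq] := IH t; first by move: hN mE; nia.
(* The size of [q] is known only through its image: f preserves norms and sends p q to p t. *)
have nq : normQ p (p%:R * q) < 1.
  rewrite -(padic_norm_ratp pr) -padic_norm_schneider_sum schneider_sum_mulp hq.
  rewrite -rmorphM padic_norm_ratp -[p%:R]/(p%:Z%:~R) -rmorphM normQ_int_lt1 //.
  exact: dvdz_mulr.
have nkq : normQ p (k%:R + p%:R * q) = 1.
  rewrite -(padic_norm_ratp pr) rmorphD rmorph_nat.
  rewrite padic_normD_dominant padic_norm_digit ?k0 //.
  by rewrite padic_norm_ratp.
(* The inverse of a unit whose residue is [k]: its first digit is [k] and its image under tau is p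
   q. *)
exists (k%:R + p%:R * q)^-1.
have kq : (k%:R + p%:R * q)^-1^-1 - k%:R = p%:R * q.
  by rewrite invrK addrAC subrr add0r.
rewrite (schneider_sum_unit_rat kp) ?kq //; last by rewrite normQV // nkq invr1.
rewrite schneider_sum_mulp hq mE -(rmorph_nat ratp) -rmorphM -rmorphD; congr (ratp _).
by rewrite rmorphD rmorphM /= addrC mulrC.
Qed.

(** Split the denominator as s p^l with s prime to p; homogeneity extracts p^-l and
    [schneider_sum_frac] makes the rest an integer. *)
Lemma schneider_sum_rat q : padicZV pr (f (ratp q)).
Proof.
have d0 : (0 < `|denq q|)%N by rewrite absz_gt0 denq_neq0.
have [s cs ds] := pfactor_coprime pr d0.
set l := logn p _ in ds.
have ps : ~~ (p %| s%:Z)%Z by rewrite dvdzE /= -prime_coprime.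
have [m hm] := schneider_sum_frac (numq q) ps.
have -> : q = p%:R ^ (- l%:Z) * ((numq q)%:~R / s%:~R).
  rewrite -[q in LHS]divq_num_den -(gez0_abs (denq_ge0 q)) ds PoszM rmorphM /=.
  by rewrite -exprnN -natrX mulrCA invfM [_^-1 * _^-1]mulrC.
rewrite rmorphM schneider_sum_exprz hm -rmorphM.
exists (p%:R ^ (- l%:Z) * m%:~R) => //; exists m, l.
by rewrite mulrC exprnN.
Qed.

Lemma schneider_sum_onto (y : Qp) : padicZV pr y -> exists q, f (ratp q) = y.
Proof.
move=> [_ [a [n ->]] <-]; have [q hq] := schneider_sum_onto_int a.
exists (p%:R ^ (- n%:Z) * q); rewrite rmorphM schneider_sum_exprz hq -rmorphM.
by rewrite mulrC exprnN.
Qed.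

End RationalPoints.

Theorem theorem3p5 (p : nat) (pr : prime p) :
  (forall x : padic pr, padicQ pr x <-> padicZV pr (schneider_sum pr x)) /\
  schneider_sum pr @` padicQ pr = padicZV pr.
Proof.
split=> [x|]; last (apply/seteqP; split=> y).
- split=> [[q _ <-]|]; first exact: schneider_sum_rat.
  (* Some rational has the same image as [x], so injectivity identifies it with [x]. *)
  by move=> /schneider_sum_onto[q /schneider_sum_inj <-]; exists q.
- by move=> [_ [q _ <-] <-]; apply: schneider_sum_rat.
- by move=> /schneider_sum_onto[q <-]; exists (ratp pr q) => //; exists q.
Qed.
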